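(* Let $\mu\ge 0$, let $f:\mathbb{R}^n\to\mathbb{R}$ be continuously differentiable, let $h:\mathbb{R}^n\to\mathbb{R}$ be continuously differentiable and strictly convex, and let $\alpha,\beta,\gamma:[0,\infty)\to\mathbb{R}$ be continuously differentiable functions of $t$. Consider the unified Bregman Lagrangian $$\mathcal{L}(X,\dot X,t)=e^{\alpha+\gamma}\left(\left(1+\mu e^{\beta}\right)D_h\left(X+e^{-\alpha}\dot X,X\right)-e^{\beta}f(X)\right).$$ Under the ideal scaling condition $\dot\gamma=e^{\alpha}$, the Euler--Lagrange equation $$\frac{d}{dt}\left\{\frac{\partial\mathcal{L}}{\partial\dot X}(X,\dot X,t)\right\}=\frac{\partial\mathcal{L}}{\partial X}(X,\dot X,t)$$ for this Lagrangian reduces to the following system of ODEs: $$\dot X=e^{\alpha}(Z-X),$$ $$\frac{d}{dt}\nabla h(Z)=\frac{\mu\dot\beta e^{\beta}}{1+\mu e^{\beta}}\left(\nabla h(X)-\nabla h(Z)\right)-\frac{e^{\alpha+\beta}}{1+\mu e^{\beta}}\nabla f(X).$$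
   Context: $D_h(y,x)=h(y)-h(x)-\langle\nabla h(x),y-x\rangle$ is the Bregman divergence of $h$. In $\mathcal{L}$ and in the system, the functions $\alpha,\beta,\gamma$ are evaluated at $t$. The curve $Z$ is the one determined by the first equation of the system, that is, $Z=X+e^{-\alpha}\dot X$.
   Formalization: Since h is only continuously differentiable, the partial derivative of the Lagrangian in X need not exist; it is additionally assumed that at each point X(t) the Lagrangian is differentiable in X for every velocity (automatic if h is twice differentiable). *)

(* Defs.v *)
From HB Require Import structures.
From mathcomp Require Import all_boot all_order all_algebra.
From mathcomp Require Import all_classical all_reals all_analysis.

Set Implicit Arguments.
Unset Strict Implicit.
Unset Printing Implicit Defensive.
Import Order.TTheory GRing.Theory Num.Theory.
Import numFieldNormedType.Exports.
Local Open Scope classical_set_scope.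
Local Open Scope ring_scope.

Section SpaceCalculus.
Context {R : realType} {n : nat}.
Implicit Types (f h : 'rV[R]_n -> R) (x y u v : 'rV[R]_n).

Definition inner u v : R := \sum_(i < n) u ord0 i * v ord0 i.

(* Meaningful at points where f is differentiable. *)
Definition grad f x : 'rV[R]_n := \row_(i < n) 'D_(delta_mx ord0 i) f x.

Definition continuously_differentiable f : Prop :=
  (forall x, differentiable f x) /\ continuous (grad f).

Definition strictly_convex f : Prop :=
  forall x y (s : R), x != y -> 0 < s < 1 ->
    f (s *: x + (1 - s) *: y) < s * f x + (1 - s) * f y.

Definition bregman_div h y x : R := h y - h x - inner (grad h x) (y - x).

End SpaceCalculus.

(* Functions of time live on [0, +oo[: they are represented by total functions
   on R whose values at negative times are never used, and their derivative is
   the limit of difference quotients taken inside [0, +oo[ (two-sided for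
   t > 0, one-sided at t = 0). *)
Section TimeCalculus.
Context {R : realType} {V : normedModType R}.
Implicit Types (u : R -> V) (t : R).

Definition is_tderive u t (l : V) : Prop :=
  (s - t)^-1 *: (u s - u t) @[s --> within `[0, +oo[ t^'] --> l.

Definition tderivable u t : Prop := exists l, is_tderive u t l.

Definition tderive u t : V :=
  lim ((s - t)^-1 *: (u s - u t) @[s --> within `[0, +oo[ t^']).

Definition continuously_tderivable u : Prop :=
  (forall t, 0 <= t -> tderivable u t) /\
  {within `[0, +oo[, continuous (tderive u)}.

End TimeCalculus.

Section Lagrangian.
Context {R : realType} {n : nat}.
(* L x v t : Lagrangian at position x, velocity v and time t *)
Implicit Types (L : 'rV[R]_n -> 'rV[R]_n -> R -> R) (X Z : R -> 'rV[R]_n).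

Definition dL_dvelocity L x v t : 'rV[R]_n := grad (fun w => L x w t) v.

Definition dL_dposition L x v t : 'rV[R]_n := grad (fun y => L y v t) x.

(* The derivatives occurring in the equation are required to exist. *)
Definition euler_lagrange L X : Prop :=
  forall t, 0 <= t ->
    [/\ differentiable (fun w => L (X t) w t) (tderive X t),
        differentiable (fun y => L y (tderive X t) t) (X t) &
        is_tderive (fun s => dL_dvelocity L (X s) (tderive X s) s) t
                   (dL_dposition L (X t) (tderive X t) t)].

Definition bregman_lagrangian (mu : R) (alpha beta gamma : R -> R)
    (f h : 'rV[R]_n -> R) (x v : 'rV[R]_n) (t : R) : R :=
  expR (alpha t + gamma t) *
  ((1 + mu * expR (beta t)) * bregman_div h (x + expR (- alpha t) *: v) x
   - expR (beta t) * f x).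

(* At position x and time t, the partial derivative of L in the position exists
   for every velocity.  For the Bregman Lagrangian with h only continuously
   differentiable this is not automatic: bregman_div contains grad h x, so it
   amounts to grad h being differentiable at x (which holds for every x as soon
   as h is twice differentiable). *)
Definition position_differentiable L x t : Prop :=
  forall v, differentiable (fun y => L y v t) x.

Definition bregman_system (mu : R) (alpha beta : R -> R)
    (f h : 'rV[R]_n -> R) X Z : Prop :=
  forall t, 0 <= t ->
    is_tderive X t (expR (alpha t) *: (Z t - X t)) /\
    is_tderive (fun s => grad h (Z s)) t
      ((mu * tderive beta t * expR (beta t) / (1 + mu * expR (beta t)))
         *: (grad h (X t) - grad h (Z t))
       - (expR (alpha t + beta t) / (1 + mu * expR (beta t)))
         *: grad f (X t)).

End Lagrangian.

(* Main.v *)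
Require Import Defs.
From HB Require Import structures.
From mathcomp Require Import all_boot all_order all_algebra.
From mathcomp Require Import all_classical all_reals all_analysis.
From mathcomp Require Import ring lra.

Set Implicit Arguments.
Unset Strict Implicit.
Unset Printing Implicit Defensive.
Import Order.TTheory GRing.Theory Num.Theory.
Import numFieldNormedType.Exports.
Local Open Scope classical_set_scope.
Local Open Scope ring_scope.

(** Write [A = 1 + mu * expR beta], [Z = X + expR (- alpha) *: X'] and
    [H = 'd (grad h) (X t)].  The momentum of the Lagrangian is
    [expR gamma * A *: (grad h Z - grad h X)], and its force is
    [expR (alpha + gamma) *: (A *: (grad h Z - grad h X
    - H (expR (- alpha) *: X')) - expR beta *: grad f X)].  Differentiate the
    momentum in time.  The ideal scaling turns the derivative of [expR gamma]
    into [expR (alpha + gamma)], which matches the first term of the force; the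
    derivative of [grad h X] is [H X'], which matches the Hessian term.  What
    remains, divided by [expR gamma * A], is the second equation of the system;
    the first one is the definition of [Z].  The weight [expR gamma * A] never
    vanishes and [grad h X] is derivable, so that the momentum is derivable
    exactly when [grad h Z] is, and the two equations are equivalent
    ([is_tderive_weighted]).

    Two points need care, because [h] is only continuously differentiable.
    First, [grad h] has to be differentiable at [X t].  The Lagrangian is
    differentiable in the position for every velocity, and up to differentiable
    terms it is a nonzero multiple of the derivative of [h] in an arbitrary
    direction, so all partial derivatives of [h] are differentiable at [X t]
    ([differentiable_derive], [differentiable_grad]).

    Second, the force contains the gradient of [y |-> <grad h y, w>], that is,
    the transpose of [H] applied to [w], whereas the chain rule yields [H]
    itself.  So [H] must be symmetric, knowing only that [grad h] is
    differentiable at this one point.  This is [second_derivative_sym], proved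
    by computing the limit of the second differences of [h] with the mean value
    theorem. *)

(** * Symmetry of second derivatives *)

Section SecondDerivative.
Context {R : realType} {V : normedModType R}.
Implicit Types (h : V -> R) (x u v : V).

Lemma differentiable_estimate (W : normedModType R) (g : V -> W) x (e : R) :
  differentiable g x -> 0 < e ->
  \forall w \near (0 : V), `|g (x + w) - g x - 'd g x w| <= e * `|w|.
Proof.
move=> /diff_locally /eqaddoP dg e0.
have := dg e e0.
apply: filterS => w /=.
by rewrite !fctE /= /cst opprD addrA [w + x]addrC.
Qed.

Lemma is_derive_line h x u (r : R) : differentiable h (x + r *: u) ->
  is_derive r 1 (fun s => h (x + s *: u)) ('D_u h (x + r *: u)).
Proof.
move=> dh.
pose l (s : R) : V := x + s *: u.
have dl : is_diff r l (fun s => s *: u).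
  have -> : l = cst x + ( *:%R ^~ u) by [].
  by apply: is_diff_eq; rewrite add0r.
have dh' : is_diff (l r) h ('d h (l r)) by exact/differentiableP.
have hl : is_diff r (h \o l) ('d h (l r) \o (fun s => s *: u)) by exact: is_diff_comp.
have dhl : differentiable (h \o l) r by [].
apply: DeriveDef; first exact: diff_derivable.
by rewrite (deriveE _ dhl) diff_val /= scale1r deriveE.
Qed.

(** On the segment from [x] to [x + s u], the increment of
    [y |-> h (y + s v) - h y] is, by the mean value theorem, [s] times an
    increment of ['D_u h] between two points at distance O(s) of [x]; the
    differentiability of ['D_u h] at the single point [x] then evaluates it as
    [s ^+ 2 * 'd ('D_u h) x v] up to o(s^2). *)
Lemma second_difference_cvg h x u v :
  (forall y, differentiable h y) -> differentiable ('D_u h) x ->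
  s^-2 * (h (x + s *: u + s *: v) - h (x + s *: u) - h (x + s *: v) + h x)
    @[s --> (0 : R)^'+] --> 'd ('D_u h) x v.
Proof.
move=> dh dg; apply/cvgrPdist_le => e e0.
(* The error is at most s^-1 (e / C) (|w1| + |w2|) with w1 = s v + c u and
   w2 = c u, where 0 <= c <= s; hence this choice of C. *)
pose C := (`|u| + `|v|) + `|u| + 1.
have C0 : 0 < C by rewrite ltr_wpDl.
have [d /= d0 Hd] := (nbhs_ballP _ _).1 (differentiable_estimate dg (divr_gt0 e0 C0)).
near=> s.
have s0 : 0 < s by near: s; exact: nbhs_right_gt.
have sC : s * C < d.
  rewrite -ltr_pdivlMr//; near: s; apply: nbhs_right_lt; exact: divr_gt0.
pose phi (r : R) := h (x + s *: v + r *: u) - h (x + r *: u).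
pose dphi (r : R) : R := 'D_u h (x + s *: v + r *: u) - 'D_u h (x + r *: u).
have dphiP (r : R) : is_derive r 1 phi (dphi r).
  by apply: is_deriveB; exact: is_derive_line.
have [|c] := @MVT_segment R phi dphi 0 s (ltW s0) (fun r _ => dphiP r).
  apply: continuous_subspaceT => r; apply: differentiable_continuous.
  by apply/derivable1_diffP; case: (dphiP r).
rewrite in_itv/= => /andP[c0 cs] E.
have -> : h (x + s *: u + s *: v) - h (x + s *: u) - h (x + s *: v) + h x =
    dphi c * s.
  rewrite -[s in RHS]subr0 -E /phi !scale0r !addr0 (addrAC x).
  by ring.
have nc : `|c *: u| <= s * `|u| by rewrite normrZ ger0_norm// ler_wpM2r.
have nsv : `|s *: v| = s * `|v| by rewrite normrZ gtr0_norm.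
have est w : `|w| <= s * (`|u| + `|v|) ->
   `|'D_u h (x + w) - 'D_u h x - 'd ('D_u h) x w| <= e / C * `|w|.
  move=> wb; apply: Hd; rewrite -ball_normE/= sub0r normrN.
  apply: le_lt_trans wb _; apply: le_lt_trans sC; rewrite ler_pM2l// /C.
  by rewrite -addrA lerDl addr_ge0.
have nw1 : `|s *: v + c *: u| <= s * (`|u| + `|v|).
  by rewrite (le_trans (ler_normD _ _))// nsv mulrDr addrC lerD.
have nw2 : `|c *: u| <= s * (`|u| + `|v|).
  by rewrite (le_trans nc)// ler_pM2l// lerDl.
have e1 := est _ nw1; have e2 := est _ nw2.
have -> : 'd ('D_u h) x v - s^-2 * (dphi c * s) =
   s^-1 * (('D_u h (x + c *: u) - 'D_u h x - 'd ('D_u h) x (c *: u)) -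
   ('D_u h (x + (s *: v + c *: u)) - 'D_u h x - 'd ('D_u h) x (s *: v + c *: u))).
  have -> : 'd ('D_u h) x (s *: v + c *: u) =
      s * 'd ('D_u h) x v + 'd ('D_u h) x (c *: u).
    by rewrite linearD linearZ.
  rewrite /dphi addrA.
  by field; rewrite gt_eqF.
rewrite normrM gtr0_norm ?invr_gt0// mulrC ler_pdivrMr//.
apply: le_trans (ler_normB _ _) _.
apply: (le_trans (lerD e2 e1)).
rewrite -mulrDr -mulrA ler_pM2l// mulrC ler_pdivrMr//.
apply: (@le_trans _ _ (s * `|u| + s * (`|u| + `|v|))); first exact: lerD.
by rewrite -mulrDr ler_pM2l// /C; lra.
Unshelve. all: by end_near. Qed.

(** The second difference of [h] is symmetric in [u] and [v], and both iterated
    derivatives are the limit of its quotients. *)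
Lemma second_derivative_sym h x u v :
  (forall y, differentiable h y) ->
  differentiable ('D_u h) x -> differentiable ('D_v h) x ->
  'D_v ('D_u h) x = 'D_u ('D_v h) x.
Proof.
move=> dh du dv; rewrite !deriveE//.
have cu := @second_difference_cvg h x u v dh du.
have cv := @second_difference_cvg h x v u dh dv.
apply: (cvg_unique (@norm_hausdorff _ R^o) cu).
apply: cvg_trans cv; apply: near_eq_cvg; near=> s; rewrite /=.
by rewrite (addrAC x); ring.
Unshelve. all: by end_near. Qed.

End SecondDerivative.

(** * Affine changes of variable *)

Section AffineSubstitution.
Context {R : realType} {V W : normedModType R}.
Implicit Types (h : V -> W) (x v w : V).

Lemma is_diff_shift h x w : differentiable h (x + w) ->
  is_diff x (fun y => h (y + w)) ('d h (x + w)).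
Proof.
move=> dh.
have ds : is_diff x ((id : V -> V) + cst w) id.
  by apply: is_diff_eq; rewrite addr0.
have dh' : is_diff (((id : V -> V) + cst w) x) h ('d h (x + w)).
  exact/differentiableP.
exact: (is_diff_comp ds dh').
Qed.

Lemma is_diff_affine h x (a : R) v : differentiable h (x + a *: v) ->
  is_diff v (fun w => h (x + a *: w)) (a \*: ('d h (x + a *: v) : V -> W)).
Proof.
move=> dh.
pose l : V -> V := cst x + a \*: id.
have ds : is_diff v l (a \*: id).
  by apply: is_diff_eq; rewrite add0r.
have dh' : is_diff (l v) h ('d h (x + a *: v)) by exact/differentiableP.
apply: (is_diff_eq (is_diff_comp ds dh')).
by apply/funext => w /=; exact: linearZ.
Qed.

Lemma is_diff_diff h x v : differentiable h x -> is_diff v ('d h x) ('d h x).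
Proof.
move=> dh; have c := diff_continuous dh.
apply: DiffDef; first exact: linear_differentiable.
exact: diff_lin.
Qed.

End AffineSubstitution.

(** * Derivatives with respect to time *)

Section TimeDerivative.
Context {R : realType}.
Implicit Types (t s : R).

Lemma near_time t :
  \forall s \near within `[0, +oo[ t^', 0 <= s /\ s != t.
Proof.
apply: filterI.
  by apply: filterS (@withinT _ t^' `[0, +oo[ _) => s /=; rewrite in_itv/= andbT.
by apply: cvg_within; exact: withinT.
Qed.

Lemma tderiveP (V : normedModType R) (u : R -> V) t :
  tderivable u t -> is_tderive u t (tderive u t).
Proof. by move=> du; apply/cvg_ex. Qed.

Lemma eq_is_tderive (V : normedModType R) (u w : R -> V) t (l : V) :
  0 <= t -> (forall s, 0 <= s -> u s = w s) ->
  is_tderive u t l -> is_tderive w t l.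
Proof.
move=> t0 uw; apply: cvg_trans; apply: near_eq_cvg.
by apply: filterS (near_time t) => s [s0 _]; rewrite !uw.
Qed.

Lemma is_tderive_cvg (V : normedModType R) (u : R -> V) t (l : V) :
  is_tderive u t l -> u s @[s --> within `[0, +oo[ t^'] --> u t.
Proof.
move=> du.
have id_t : s - t @[s --> within `[0, +oo[ t^'] --> (0 : R).
  rewrite -(subrr t); apply: cvgB; last exact: cvg_cst.
  by move=> A tA; do 2!apply: cvg_within.
have h : (s - t) *: ((s - t)^-1 *: (u s - u t)) + u t
    @[s --> within `[0, +oo[ t^'] --> u t.
  rewrite -[X in _ --> X]add0r -[X in _ --> X + _](scale0r l).
  by apply: cvgD; [exact: cvgZ | exact: cvg_cst].
apply: cvg_trans h; apply: near_eq_cvg.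
apply: filterS (near_time t) => s [_ st] /=.
by rewrite scalerA mulfV ?subr_eq0// scale1r subrK.
Qed.

Lemma is_tderive_cst (V : normedModType R) (c : V) t :
  is_tderive (fun=> c) t (0 : V).
Proof.
rewrite /is_tderive; under eq_fun do rewrite subrr scaler0.
exact: cvg_cst.
Qed.

Lemma is_tderiveB (V : normedModType R) (u w : R -> V) t (l m : V) :
  is_tderive u t l -> is_tderive w t m ->
  is_tderive (fun s => u s - w s) t (l - m).
Proof.
move=> du dw; apply: cvg_trans (cvgB du dw); apply: near_eq_cvg.
by apply: nearW => s; rewrite !fctE -scalerBr opprD addrACA -opprD.
Qed.

Lemma is_tderiveD (V : normedModType R) (u w : R -> V) t (l m : V) :
  is_tderive u t l -> is_tderive w t m ->
  is_tderive (fun s => u s + w s) t (l + m).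
Proof.
move=> du dw; apply: cvg_trans (cvgD du dw); apply: near_eq_cvg.
by apply: nearW => s; rewrite !fctE -scalerDr opprD addrACA.
Qed.

Lemma is_tderiveZ (V : normedModType R) (a : R -> R) (u : R -> V) t
    (da : R) (du : V) :
  is_tderive a t da -> is_tderive u t du ->
  is_tderive (fun s => a s *: u s) t (a t *: du + da *: u t).
Proof.
move=> ha hu.
have h : a s *: ((s - t)^-1 *: (u s - u t)) + ((s - t)^-1 *: (a s - a t)) *: u t
    @[s --> within `[0, +oo[ t^'] --> a t *: du + da *: u t.
  apply: cvgD; first exact: cvgZ (is_tderive_cvg ha) hu.
  exact: cvgZr_tmp.
apply: cvg_trans h; apply: near_eq_cvg; apply: nearW => s /=.
have -> : ((s - t)^-1 *: (a s - a t)) *: u t = (s - t)^-1 *: ((a s - a t) *: u t).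
  by rewrite scalerA.
rewrite scalerA mulrC -scalerA -scalerDr.
by rewrite scalerBr scalerBl addrA subrK.
Qed.

(** The curve [u] is tangent to [l] at [t] but need not be straight, so a
    directional derivative of [g] along [l] would not suffice: the Frechet
    differential controls [g] on the whole neighbourhood of [u t]. *)
Lemma is_tderive_comp (V W : normedModType R) (g : V -> W) (u : R -> V) t
    (l : V) :
  differentiable g (u t) -> is_tderive u t l ->
  is_tderive (g \o u) t ('d g (u t) l).
Proof.
move=> dg du; apply/cvgrPdist_le => e e0.
have C0 : 0 < 2 * (`|l| + 1) by rewrite mulr_gt0// ltr_wpDl.
have uc : u s - u t @[s --> within `[0, +oo[ t^'] --> (0 : V).
  by rewrite -(subrr (u t)); apply: cvgB (is_tderive_cvg du) (cvg_cst _).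
have est := uc _ (differentiable_estimate dg (divr_gt0 e0 C0)).
have dgc : 'd g (u t) ((s - t)^-1 *: (u s - u t))
    @[s --> within `[0, +oo[ t^'] --> 'd g (u t) l.
  by apply: cvg_comp du _; exact: diff_continuous.
have half : 0 < e / 2 by rewrite divr_gt0.
near=> s.
have h1 : `|'d g (u t) l - 'd g (u t) ((s - t)^-1 *: (u s - u t))| <= e / 2.
  by near: s; move/cvgrPdist_le: dgc; exact.
have h2 : `|g (u t + (u s - u t)) - g (u t) - 'd g (u t) (u s - u t)|
    <= e / (2 * (`|l| + 1)) * `|u s - u t|.
  by near: s; exact: est.
(* The difference quotient converges, so it is eventually bounded. *)
have h3 : `|(s - t)^-1 *: (u s - u t)| <= `|l| + 1.
  near: s; move/cvgrPdist_le: du => /(_ 1 ltr01); apply: filterS => s h.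
  rewrite -[X in `|X|](subKr l); apply: le_trans (ler_normB _ _) _.
  by rewrite lerD2l.
rewrite [u t + _]addrC subrK in h2.
have -> : 'd g (u t) l - (s - t)^-1 *: ((g \o u) s - (g \o u) t) =
    ('d g (u t) l - 'd g (u t) ((s - t)^-1 *: (u s - u t))) -
    (s - t)^-1 *: (g (u s) - g (u t) - 'd g (u t) (u s - u t)).
  have -> : 'd g (u t) ((s - t)^-1 *: (u s - u t)) =
      (s - t)^-1 *: 'd g (u t) (u s - u t) by exact: linearZ.
  rewrite [X in _ = _ - X]scalerBr /=.
  by move: ('d g _ _) => D; rewrite [X in _ = _ - X]addrC addrKA.
apply: le_trans (ler_normB _ _) _; rewrite [leRHS]splitr lerD// normrZ.
rewrite normrZ in h3.
apply: (le_trans (ler_wpM2l (normr_ge0 _) h2)).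
rewrite mulrCA; apply: (le_trans (ler_wpM2l _ h3)).
  exact/ltW/divr_gt0.
by rewrite le_eqVlt; apply/orP; left; apply/eqP; field; rewrite gt_eqF// ltr_wpDl.
Unshelve. all: by end_near. Qed.

End TimeDerivative.

Section ScalarTimeDerivative.
Context {R : realType}.
Implicit Types (a u : R -> R) (t l : R).

Lemma is_tderive_expR u t l :
  is_tderive u t l -> is_tderive (fun s => expR (u s)) t (expR (u t) * l).
Proof.
move=> du; have [dE eE] := is_derive_expR (u t).
have dexp : differentiable (expR : R -> R) (u t) by exact/derivable1_diffP.
suff <- : 'd expR (u t) l = expR (u t) * l by exact: is_tderive_comp.
rewrite -[l in LHS]mulr1 [RHS]mulrC -eE deriveE//.
exact: linearZ.
Qed.

Lemma is_tderiveV a t l : a t != 0 ->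
  is_tderive a t l -> is_tderive (fun s => (a s)^-1) t (- (a t)^-2 * l).
Proof.
move=> a0 da.
suff <- : 'd GRing.inv (a t) l = - (a t)^-2 * l.
  by apply: is_tderive_comp => //; exact: differentiable_Rinv.
by rewrite diff_Rinv.
Qed.

(** Since [a] does not vanish and [K] is derivable, the derivability of
    [a *: (G - K)] and that of [G] are equivalent; this gives the existence of
    the derivative of [G] in both directions, and not only its value. *)
Lemma is_tderive_weighted (V : normedModType R) a (G K : R -> V) t l (q k : V) :
  0 <= t -> (forall s, a s != 0) -> is_tderive a t l -> is_tderive K t k ->
  is_tderive (fun s => a s *: (G s - K s)) t q <->
  is_tderive G t ((a t)^-1 *: (q - l *: (G t - K t)) + k).
Proof.
move=> t0 a0 da dK; split=> [dQ|dG].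
- have := is_tderiveD (is_tderiveZ (is_tderiveV (a0 t) da) dQ) dK.
  rewrite scalerA [_ * l]mulrC mulrN mulNr -!mulrA.
  have -> : l * ((a t)^-2 * a t) = (a t)^-1 * l.
    by have := a0 t => at0; field.
  rewrite scaleNr -scalerA -scalerBr.
  apply: eq_is_tderive => // s _.
  by rewrite scalerA mulVf// scale1r subrK.
- have := is_tderiveZ da (is_tderiveB dG dK).
  by rewrite addrK scalerA mulfV// scale1r subrK.
Qed.

End ScalarTimeDerivative.

(** * Gradients *)

Section Gradient.
Context {R : realType} {n : nat}.
Implicit Types (f h : 'rV[R]_n -> R) (x v w : 'rV[R]_n).

Lemma inner_grad h x v : differentiable h x -> inner (grad h x) v = 'D_v h x.
Proof.
move=> dh; rewrite deriveE// [in RHS](row_sum_delta v) linear_sum.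
apply: eq_bigr => i _; rewrite linearZ /= mxE deriveE// mulrC.
by [].
Qed.

Lemma differentiable_grad h x :
  (forall i : 'I_n, differentiable ('D_(delta_mx ord0 i) h) x) ->
  differentiable (grad h) x.
Proof.
move=> dh.
have -> : grad h = \sum_(i < n)
    (fun y => 'D_(delta_mx ord0 i) h y *: (delta_mx ord0 i : 'rV[R]_n)).
  apply/funext => y; rewrite [LHS]row_sum_delta fct_sumE.
  by apply: eq_bigr => i _; rewrite mxE.
by apply: differentiable_sum => i; apply: differentiableZl.
Qed.

Lemma diff_grad_coord h x v (i : 'I_n) : differentiable (grad h) x ->
  ('d (grad h) x v) ord0 i = 'D_v ('D_(delta_mx ord0 i) h) x.
Proof.
move=> dg; rewrite -deriveE// derive_mx; last exact: diff_derivable.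
rewrite mxE; congr ('D_v _ x).
by apply/funext => y; rewrite mxE.
Qed.

(** The position derivative of the Lagrangian produces the left-hand side (the
    [i]-th partial derivative of [y |-> <grad h y, w>]), the chain rule along
    the curve produces the right-hand side. *)
Lemma diff_derive_sym h x w (i : 'I_n) :
  (forall y, differentiable h y) ->
  (forall v, differentiable ('D_v h) x) ->
  'd ('D_w h) x (delta_mx ord0 i) = ('d (grad h) x w) ord0 i.
Proof.
move=> dh ddh; rewrite diff_grad_coord; last exact: differentiable_grad.
by rewrite -(deriveE _ (ddh w)); exact: second_derivative_sym.
Qed.

Lemma is_diff_grad f x (df : 'rV[R]_n -> R) :
  is_diff x f df -> grad f x = \row_i df (delta_mx ord0 i).
Proof.
move=> fdf; apply/rowP => i; rewrite !mxE deriveE; last by case: fdf.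
by rewrite diff_val.
Qed.

End Gradient.

(** * Partial derivatives of the Bregman Lagrangian *)

Section BregmanLagrangian.
Context {R : realType} {n : nat}.
Context (mu : R) (alpha beta gamma : R -> R) (f h : 'rV[R]_n -> R).
Hypothesis dh : forall y, differentiable h y.
Implicit Types (x v : 'rV[R]_n) (t : R).

Let L := bregman_lagrangian mu alpha beta gamma f h.

Lemma bregman_lagrangianE x v t :
  L x v t = expR (alpha t + gamma t) *
    ((1 + mu * expR (beta t)) *
       (h (x + expR (- alpha t) *: v) - h x - 'D_(expR (- alpha t) *: v) h x)
     - expR (beta t) * f x).
Proof.
rewrite /L /bregman_lagrangian /bregman_div.
set w := expR _ *: v; have -> : x + w - x = w by rewrite addrC addKr.
by rewrite inner_grad.
Qed.

Lemma is_diff_velocity x v t :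
  is_diff v (fun w => L x w t)
    (fun w => expR (alpha t + gamma t) * ((1 + mu * expR (beta t)) *
       (expR (- alpha t) * 'd h (x + expR (- alpha t) *: v) w
        - expR (- alpha t) * 'd h x w))).
Proof.
set a := expR (- alpha t).
pose F := expR (alpha t + gamma t) \*: ((1 + mu * expR (beta t)) \*:
   ((fun w => h (x + a *: w)) - cst (h x) - a \*: ('d h x : _ -> R))
   - cst (expR (beta t) * f x)) : 'rV[R]_n -> R.
have -> : (fun w => L x w t) = F.
  by apply/funext => w; rewrite bregman_lagrangianE deriveE// linearZ.
have d1 := @is_diff_affine _ _ _ h x a v (dh _).
have d2 := @is_diff_diff _ _ _ h x v (dh _).
apply: is_diff_eq; apply/funext => w; rewrite !fctE /=.
have z (r : R) : r - (0 : 'rV[R]_n -> R) w = r by exact: subr0.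
by rewrite !z.
Qed.

Lemma dL_dvelocityE x v t :
  dL_dvelocity L x v t = (expR (gamma t) * (1 + mu * expR (beta t))) *:
     (grad h (x + expR (- alpha t) *: v) - grad h x).
Proof.
rewrite /dL_dvelocity (is_diff_grad (is_diff_velocity x v t)).
apply/rowP => i; rewrite !mxE !deriveE//.
(* The factor expR (- alpha t) is the derivative of w |-> x + expR (- alpha t) *: w. *)
have -> : expR (gamma t) = expR (alpha t + gamma t) * expR (- alpha t).
  by rewrite -expRD addrAC subrr add0r.
have alg (c A a p q : R) : c * (A * (a * p - a * q)) = c * a * A * (p - q).
  by ring.
exact: alg.
Qed.

(** In the formula for the Lagrangian all terms but ['D_w h] are known to be
    differentiable, and its coefficient is nonzero, so that the
    differentiability of the Lagrangian passes to ['D_w h]. *)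
Lemma differentiable_derive x t (w : 'rV[R]_n) :
  0 <= mu -> differentiable f x -> position_differentiable L x t ->
  differentiable ('D_w h) x.
Proof.
move=> mu0 df dL.
set A := 1 + mu * expR (beta t).
have A0 : A != 0 by rewrite gt_eqF// ltr_wpDr// mulr_ge0// expR_ge0.
set c := expR (alpha t + gamma t).
have c0 : c != 0 by rewrite gt_eqF// expR_gt0.
(* The velocity expR (alpha t) *: w shifts the position exactly by w. *)
pose Lw y := L y (expR (alpha t) *: w) t.
have dLw : differentiable Lw x by exact: dL.
have LwE y : Lw y =
    c * (A * (h (y + w) - h y - 'D_w h y) - expR (beta t) * f y).
  by rewrite /Lw bregman_lagrangianE scalerA -expRD addNr expR0 scale1r.
clearbody Lw.
have alg (p q d r : R) :
    d = p - q - A^-1 * (c^-1 * (c * (A * (p - q - d) - expR (beta t) * r))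
      + expR (beta t) * r).
  by field; rewrite A0 c0.
have -> : 'D_w h = (fun y => h (y + w)) - h
    - A^-1 \*: (c^-1 \*: Lw + expR (beta t) \*: f).
  by apply/funext => y; rewrite !fctE /= LwE; exact: alg.
have [d1 _] := @is_diff_shift _ _ _ h x w (dh _).
apply: differentiableB; first by apply: differentiableB.
by apply: differentiableZ; apply: differentiableD; apply: differentiableZ.
Qed.

Lemma dL_dpositionE x v t :
  0 <= mu -> differentiable f x -> position_differentiable L x t ->
  dL_dposition L x v t = expR (alpha t + gamma t) *:
    ((1 + mu * expR (beta t)) *: (grad h (x + expR (- alpha t) *: v) - grad h x
        - 'd (grad h) x (expR (- alpha t) *: v))
     - expR (beta t) *: grad f x).
Proof.
move=> mu0 df dL; set w := expR (- alpha t) *: v.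
have ddh u : differentiable ('D_u h) x by exact: differentiable_derive dL.
have d1 := @is_diff_shift _ _ _ h x w (dh _).
have d2 : is_diff x h ('d h x) by exact/differentiableP.
have d3 : is_diff x ('D_w h) ('d ('D_w h) x) by exact/differentiableP.
have d4 : is_diff x f ('d f x) by exact/differentiableP.
have d : is_diff x (fun y => L y v t) (fun e => expR (alpha t + gamma t) *
    ((1 + mu * expR (beta t)) * ('d h (x + w) e - 'd h x e - 'd ('D_w h) x e)
      - expR (beta t) * 'd f x e)).
  have -> : (fun y => L y v t) = expR (alpha t + gamma t) \*:
    ((1 + mu * expR (beta t)) \*: ((fun y => h (y + w)) - h - 'D_w h)
      - expR (beta t) \*: f).
    by apply/funext => y; rewrite bregman_lagrangianE.
  exact: is_diff_eq.
rewrite /dL_dposition (is_diff_grad d); apply/rowP => i.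
rewrite !mxE; congr (_ * (_ * (_ - _ - _) - _ * _)).
- by rewrite deriveE.
- by rewrite deriveE.
- exact: diff_derive_sym.
- by rewrite deriveE.
Qed.

End BregmanLagrangian.

(** * Equivalence of the two systems *)

Theorem proposition2 (R : realType) (n : nat) (mu : R)
    (f h : 'rV[R]_n -> R) (alpha beta gamma : R -> R)
    (X Z : R -> 'rV[R]_n)
    (mu_ge0 : 0 <= mu)
    (f_C1 : continuously_differentiable f)
    (h_C1 : continuously_differentiable h)
    (h_convex : strictly_convex h)
    (alpha_C1 : continuously_tderivable alpha)
    (beta_C1 : continuously_tderivable beta)
    (gamma_C1 : continuously_tderivable gamma)
    (ideal_scaling : forall t, 0 <= t -> tderive gamma t = expR (alpha t))
    (X_derivable : forall t, 0 <= t -> tderivable X t)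
    (Z_def : forall t, 0 <= t ->
       Z t = X t + expR (- alpha t) *: tderive X t)
    (L_derivable : forall t, 0 <= t ->
       position_differentiable
         (bregman_lagrangian mu alpha beta gamma f h) (X t) t) :
  euler_lagrange (bregman_lagrangian mu alpha beta gamma f h) X <->
  bregman_system mu alpha beta f h X Z.
Proof.
have dh := h_C1.1; have df := f_C1.1.
pose A s := 1 + mu * expR (beta s).
pose a s := expR (gamma s) * A s.
have A0 s : A s != 0.
  by rewrite gt_eqF// ltr_wpDr// mulr_ge0// expR_ge0.
have a0 s : a s != 0 by rewrite mulf_neq0// gt_eqF// expR_gt0.
pose da t := expR (gamma t) * (mu * (expR (beta t) * tderive beta t))
  + expR (gamma t) * expR (alpha t) * A t.
have a_tderive t : 0 <= t -> is_tderive a t (da t).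
  move=> t0.
  have dg := is_tderive_expR (tderiveP (gamma_C1.1 t t0)).
  have db := is_tderive_expR (tderiveP (beta_C1.1 t t0)).
  rewrite ideal_scaling// in dg.
  have dA : is_tderive A t (mu * (expR (beta t) * tderive beta t)).
    have := is_tderiveD (is_tderive_cst (1 : R) t)
      (is_tderiveZ (is_tderive_cst mu t) db).
    by rewrite scale0r addr0 add0r.
  exact: is_tderiveZ dg dA.
have X_tderive t : 0 <= t -> is_tderive X t (tderive X t).
  by move=> t0; exact/tderiveP/X_derivable.
have dgrad t : 0 <= t -> differentiable (grad h) (X t).
  move=> t0; apply: differentiable_grad => i.
  exact: differentiable_derive (L_derivable t t0).
have K_tderive t : 0 <= t -> is_tderive (fun s => grad h (X s)) t
    ('d (grad h) (X t) (tderive X t)).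
  by move=> t0; apply: is_tderive_comp (dgrad t t0) (X_tderive t t0).
pose L := bregman_lagrangian mu alpha beta gamma f h.
have momentumE s : 0 <= s ->
    dL_dvelocity L (X s) (tderive X s) s = a s *: (grad h (Z s) - grad h (X s)).
  by move=> s0; rewrite Z_def//; exact: dL_dvelocityE.
pose rhs t := (mu * tderive beta t * expR (beta t) / (1 + mu * expR (beta t)))
         *: (grad h (X t) - grad h (Z t))
       - (expR (alpha t + beta t) / (1 + mu * expR (beta t)))
         *: grad f (X t).
(* The right-hand side of the system is what solving the Euler-Lagrange
   equation for the derivative of grad h (Z t) gives: the Hessian terms
   cancel, and the term in the derivative of gamma cancels the first term of
   the force. *)
have rhsE t : 0 <= t -> rhs t =
    (a t)^-1 *: (dL_dposition L (X t) (tderive X t) t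
                 - da t *: (grad h (Z t) - grad h (X t)))
    + 'd (grad h) (X t) (tderive X t).
  move=> t0; rewrite /L.
  rewrite (dL_dpositionE dh (tderive X t) mu_ge0 (df (X t)) (L_derivable t t0)).
  rewrite -Z_def//.
  have -> : 'd (grad h) (X t) (expR (- alpha t) *: tderive X t) =
    expR (- alpha t) *: 'd (grad h) (X t) (tderive X t) by exact: linearZ.
  rewrite /rhs; move: (grad h (Z t)) (grad h (X t)) (grad f (X t))
    ('d (grad h) (X t) (tderive X t)) => G K F k.
  apply/rowP => i; rewrite !mxE !expRD expRN /a /da -/(A t).
  have := A0 t; have ea : expR (alpha t) != 0 by rewrite gt_eqF// expR_gt0.
  have eg : expR (gamma t) != 0 by rewrite gt_eqF// expR_gt0.
  rewrite /A => At.
  by field; rewrite At ea eg.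
have EL_iff t : 0 <= t ->
    is_tderive (fun s => dL_dvelocity L (X s) (tderive X s) s) t
      (dL_dposition L (X t) (tderive X t) t) <->
    is_tderive (fun s => grad h (Z s)) t (rhs t).
  move=> t0; rewrite (rhsE t t0).
  apply: iff_trans (is_tderive_weighted _ _ t0 a0 (a_tderive t t0) (K_tderive t t0)).
  by split; apply: eq_is_tderive => // s s0; rewrite momentumE.
split=> [EL t t0|S t t0].
- have [_ _ /(EL_iff t t0) dZ] := EL t t0; split=> //.
  rewrite Z_def// [X t + _]addrC addrK scalerA -expRD subrr expR0 scale1r.
  exact: X_tderive.
- have [_ dZ] := S t t0; split; last exact/EL_iff.
  + by case: (is_diff_velocity mu alpha beta gamma f dh (X t) (tderive X t) t).
  + exact: L_derivable.
Qed.
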